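(* For every $p\in(0,1)$ and every $n\ge 1$, the number $X_n=X_n(p)$ of correct guesses under the optimal strategy in the complete feedback game after one asymmetric single-shelf shuffle of $n$ cards with parameter $p$ is log-concave; that is, $\mathbb{P}(X_n=k)^2\ge \mathbb{P}(X_n=k-1)\,\mathbb{P}(X_n=k+1)$ for all integers $k\ge 1$.
   Context: Asymmetric single-shelf shuffle with parameter $p\in(0,1)$: start with an ordered deck of $n$ cards labelled $1,\dots,n$ (card $1$ on top). Cards are drawn one at a time from the bottom of the deck (card $n$ first, card $1$ last) and placed in a pile; independently, each drawn card is placed at the top of the pile with probability $p$ and at the bottom with probability $1-p$. Equivalently, let $\varepsilon_1,\dots,\varepsilon_{n-1}$ be independent Bernoulli$(p)$ ($\varepsilon_j=1$ iff card $j$ is placed at the top); the shuffled deck read from the top consists of the cards $j\le n-1$ with $\varepsilon_j=1$ in increasing order, then card $n$, then the cards with $\varepsilon_j=0$ in decreasing order. Complete feedback game: the player guesses the cards of the shuffled deck sequentially from the top; after each guess the card is shown and removed. Let $\nu=1$ if $p\ge\frac12$ and $\nu=\lfloor \log p/\log(1-p)\rfloor+1$ if $0<p<\frac12$. Optimal strategy used: let $j$ be the label of the last card shown ($j=0$ before the first guess). As long as neither card $n$ nor card $n-1$ has been shown: if $p\ge\frac12$, guess $j+1$; if $p<\frac12$, guess $n$ when $n-j\le\nu$ and guess $j+1$ when $n-j>\nu$. Once card $n$ or $n-1$ has been shown, guess the remaining cards in decreasing order. $X_n=X_n(p)$ denotes the number of correct guesses under this strategy. *)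

(* Defs.v *)
From HB Require Import structures.
From mathcomp Require Import all_boot all_order all_algebra.
From mathcomp Require Import all_classical all_reals all_analysis.

Set Implicit Arguments.
Unset Strict Implicit.
Unset Printing Implicit Defensive.
Import Order.TTheory GRing.Theory Num.Theory.
Local Open Scope ring_scope.

(* Decks, piles and lists of shown cards are sequences of labels in
   {1, ..., n}; decks and piles are read from the top, lists of shown cards
   in the order in which the cards were shown. *)

(* The card labelled j is decided by coordinate j - 1 of [eps]; [true] means
   that the card goes on top of the pile. *)
Definition coins (n : nat) := {ffun 'I_n -> bool}.

Definition coins_prob (R : realType) (p : R) (n : nat) (eps : coins n) : R :=
  \prod_(i < n) (if eps i then p else 1 - p).

(* The cards are drawn in the order n, n - 1, ..., 1. *)
Definition shuffle (n : nat) (eps : coins n) : seq nat :=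
  foldl (fun (pile : seq nat) (i : 'I_n) =>
           if eps i then i.+1 :: pile else rcons pile i.+1)
        [::] (rev (enum 'I_n)).

Lemma shuffleE (n : nat) (eps : coins n.+1) :
  shuffle eps =
    [seq (val i).+1 | i <- enum 'I_n.+1 & (i != ord_max) && eps i] ++
    n.+1 ::
    rev [seq (val i).+1 | i <- enum 'I_n.+1 & (i != ord_max) && ~~ eps i].
Proof.
have gen (s : seq 'I_n.+1) pile :
    foldl (fun (pile : seq nat) (i : 'I_n.+1) =>
             if eps i then i.+1 :: pile else rcons pile i.+1) pile (rev s) =
    [seq (val i).+1 | i <- s & eps i] ++ pile ++
    rev [seq (val i).+1 | i <- s & ~~ eps i].
  elim: s pile => [|i s IH] pile /=; first by rewrite cats0.
  rewrite rev_cons -cats1 foldl_cat IH /=.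
  by case: (eps i) => //=; rewrite rev_cons -!cats1 !catA.
rewrite /shuffle gen enum_ordSr !filter_rcons /= eqxx /=.
have nm (P : pred 'I_n.+1) :
    [seq i <- map (widen_ord (leqnSn n)) (enum 'I_n) | (i != ord_max) && P i] =
    [seq i <- map (widen_ord (leqnSn n)) (enum 'I_n) | P i].
  apply: eq_in_filter => i /mapP[j _ ->].
  by rewrite -val_eqE /= neq_ltn ltn_ord.
rewrite (nm eps) (nm (fun i => ~~ eps i)).
by case: (eps ord_max); rewrite /= map_rcons ?rev_rcons -?cats1 -?catA.
Qed.

(* [strategy shown] is the next guess once the cards [shown] have been
   revealed. *)
Fixpoint correct_guesses (strategy : seq nat -> nat) (shown deck : seq nat)
    : nat :=
  if deck is c :: deck' then
    ((strategy shown == c) + correct_guesses strategy (rcons shown c) deck')%N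
  else 0%N.

Definition nu (R : realType) (p : R) : int :=
  if 2^-1 <= p then 1 else Num.floor (ln p / ln (1 - p)) + 1.

(* For n = 1 there is no card n - 1; the label 0 never occurs in [shown]. *)
Definition optimal_strategy (R : realType) (p : R) (n : nat) (shown : seq nat)
    : nat :=
  let j := last 0%N shown in
  if (n \in shown) || (n.-1 \in shown) then
    \max_(1 <= i < n.+1 | i \notin shown) i
  else if 2^-1 <= p then j.+1
  else if n%:Z - j%:Z <= nu p then n
  else j.+1.

Definition num_correct (R : realType) (p : R) (n : nat) (eps : coins n) : nat :=
  correct_guesses (optimal_strategy p n) [::] (shuffle eps).

Definition prob_correct (R : realType) (p : R) (n k : nat) : R :=
  \sum_(eps : coins n | num_correct p eps == k) coins_prob p eps.

Lemma coins_prob_sum1 (R : realType) (p : R) (n : nat) :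
  \sum_(eps : coins n) coins_prob p eps = 1.
Proof.
rewrite /coins_prob.
rewrite -(bigA_distr_bigA (fun (_ : 'I_n) b => if b then p else 1 - p)).
by rewrite big1 // => i _; rewrite big_bool /= addrC subrK.
Qed.

(* Main.v *)
Require Import Defs.
From mathcomp Require Import all_boot all_order all_algebra.
From mathcomp Require Import all_classical all_reals all_analysis.
From mathcomp Require Import ring lra zify.
Import Order.TTheory GRing.Theory Num.Theory.
Local Open Scope ring_scope.

(** Put [q = 1 - p], let [c] be the cutoff [nu p] and [m = n - c] (truncated).
    The player guesses [n] as soon as the last card shown has label at least
    [m], and the next label before that.  When card [n] or [n - 1] has
    appeared, the cards left are decreasing and every guess is right.  Before
    that, errors are read off the coins locally: a top card of label at most
    [m] is missed exactly when the preceding label went to the bottom (label 0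
    counting as a top card), a top card of label in [m + 1, n - 1] is always
    missed, and card [n] is missed exactly when [m > 0] and all of the labels
    from [m] to [n - 1] went to the bottom.  This is [errors].

    Hence the generating functions [U] and [V] of the number of errors, given
    that the preceding card went to the top, respectively to the bottom, obey
      [U' = p U + q V],   [V' = p x U + q V]
    each time one more label is put in front, starting from laws given by the
    [s = n - 1 - m] coins of the tail.  Interleave their coefficients in one
    sequence, [w (2 e) = U_e] and [w (2 e - 1) = V_e]; the recursion becomes
    [coin_step], in which [w' d] is a combination of [w d] and [w (d - 1)]
    whose coefficients depend on the parity of [d] only.  The condition
      [w b * w (a + 2) <= w a * w (b + 2)] for [b <= a]
    is bilinear in values whose indices have prescribed parities, so it
    survives the recursion ([coin_step_skip_log_concave]), and for
    [a = b + 2 = 2 e] it is the log-concavity of [U].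

    It remains to start the induction.  With [s = 0] the condition holds before
    any coin.  With [s > 0] it may fail there and after one coin, but holds
    after two ([error_weight2_skip_log_concave]): the tail laws are
    binomial except in their first two coefficients, so that the log-concavity
    of binomial weights leaves four inequalities between small coefficients.
    These, and the log-concavity of [U] after one coin, need the tail to be
    short compared with [p]: the cutoff satisfies [q ^ c < p], from which
    [few_tail_coins] extracts [(s + 5) p >= 2]. *)

(** * Log-concavity along steps of two *)

(** For a positive sequence, [w a.+2 / w a] decreases with [a], also across
    parities.  In terms of the two interleaved sequences [U] and [V], it says
    that the rows [U], [V], [xU], [xV], [x^2 U], and so on form an array whose
    minors on adjacent columns are nonnegative. *)
Definition skip_log_concave {F : realFieldType} (w : nat -> F) : Prop :=
  forall a b, (b <= a)%N -> w b * w a.+2 <= w a * w b.+2.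

Definition initial_support {F : realFieldType} (w : nat -> F) : Prop :=
  forall d, 0 < w d.+1 -> 0 < w d.

Lemma initial_support_le {F : realFieldType} (w : nat -> F) (a b : nat) :
  initial_support w -> (a <= b)%N -> 0 < w b -> 0 < w a.
Proof.
move=> sw /subnK <-; elim: (b - a)%N => [//|d IH].
by rewrite addSn => /sw.
Qed.

(** The ratio [w a.+2 / w a] decreases as soon as it does so between
    neighbours.  Initial support is what allows dividing by [w a]: an internal
    zero would break the chain of comparisons. *)
Lemma skip_log_concave_local {F : realFieldType} (w : nat -> F) :
    (forall d, 0 <= w d) -> initial_support w ->
    (forall a, w a * w a.+3 <= w a.+1 * w a.+2) ->
  skip_log_concave w.
Proof.
move=> w0 sw loc a b /subnK <-; elim: (a - b)%N => [|d IH].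
  by rewrite add0n mulrC.
rewrite addSn; set e := (d + b)%N in IH *.
have := w0 e.+3; rewrite le_eqVlt => /orP[/eqP<-|pos].
  by rewrite mulr0 mulr_ge0.
have posk k : (k <= e.+3)%N -> 0 < w k.
  by move=> /initial_support_le; apply.
have pe := posk e ltac:(lia).
rewrite -(ler_pM2r pe) -mulrA [w e.+3 * _]mulrC.
apply: (le_trans (ler_wpM2l (w0 b) (loc e))).
rewrite mulrCA -[X in _ <= X]mulrA ler_wpM2l //.
by rewrite [w b.+2 * _]mulrC.
Qed.

(** * Putting one coin in front *)

(** The recursion [U' = p U + q V], [V' = p x U + q V] for the interleaved
    sequence [w (2 e) = U_e], [w (2 e - 1) = V_e].  The term [V_0] is absent:
    it would sit at index [-1], and vanishes. *)
Definition coin_step {F : realFieldType} (p : F) (w : nat -> F) (d : nat) : F :=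
  (if odd d then 1 - p else p) * w d +
  (if d is d'.+1 then (if odd d then p else 1 - p) * w d' else 0).

Lemma coin_step_ge0 {F : realFieldType} (p : F) (w : nat -> F) :
    0 < p -> p < 1 -> (forall d, 0 <= w d) ->
  forall d, 0 <= coin_step p w d.
Proof.
move=> p0 p1 w0 d; have q0 : 0 <= 1 - p by rewrite subr_ge0 ltW.
apply: addr_ge0; first by rewrite mulr_ge0 //; case: odd => //; exact: ltW.
by case: d => // d; rewrite mulr_ge0 //; case: odd => //; exact: ltW.
Qed.

Lemma coin_step_initial_support {F : realFieldType} (p : F) (w : nat -> F) :
    0 < p -> p < 1 -> (forall d, 0 <= w d) -> initial_support w ->
  initial_support (coin_step p w).
Proof.
move=> p0 p1 w0 sw d; have q0 : 0 < 1 - p by rewrite subr_gt0.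
move=> pos; have wd : 0 < w d.
  rewrite lt_neqAle w0 andbT eq_sym; apply/eqP => wd0.
  move: pos; rewrite /coin_step wd0 mulr0 addr0.
  rewrite pmulr_rgt0; last by case: odd.
  by move/sw; rewrite wd0 ltxx.
apply: ltr_pwDl; first by rewrite mulr_gt0 //; case: odd.
by case: d {pos wd} => // d; rewrite mulr_ge0 //; case: odd => //; exact: ltW.
Qed.

(** Expanding both sides by bilinearity gives four terms with the same
    nonnegative coefficients on the two sides, because indices differing by two
    have the same parity.  Each pair of terms is an instance of the hypothesis,
    at indices lowered by at most one; only when [a = b] could lowering [a]
    alone break [b <= a], and then both sides are equal. *)
Lemma coin_step_skip_log_concave {F : realFieldType} (p : F) (w : nat -> F) :
    0 < p -> p < 1 -> (forall d, 0 <= w d) -> skip_log_concave w ->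
  skip_log_concave (coin_step p w).
Proof.
move=> p0 p1 w0 lcw.
pose al d := if odd d then 1 - p else p.
pose be d := if odd d then p else 1 - p.
pose pr d := if d is d'.+1 then w d' else 0.
have stepE d : coin_step p w d = al d * w d + be d * pr d.
  by case: d => [|d]; rewrite /coin_step //= /pr mulr0.
have al2 d : al d.+2 = al d by rewrite /al /= negbK.
have be2 d : be d.+2 = be d by rewrite /be /= negbK.
have al0 d : 0 <= al d by rewrite /al; case: odd; lra.
have be0 d : 0 <= be d by rewrite /be; case: odd; lra.
move=> a b; rewrite leq_eqVlt => /orP[/eqP->|ltba]; first by rewrite mulrC.
rewrite !stepE !al2 !be2 /=.
have H1 := lcw a b (ltnW ltba).
have H2 : w b * w a.+1 <= pr a * w b.+2.
  by case: a ltba {H1} => // a ltba; apply: lcw.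
have H3 : pr b * w a.+2 <= w a * w b.+1.
  case: b ltba {H1 H2} => [|b] ltba /=; first by rewrite mul0r mulr_ge0.
  by apply: lcw; lia.
have H4 : pr b * w a.+1 <= pr a * w b.+1.
  case: a b ltba {H1 H2 H3} => // a [|b] ltba /=;
    first by rewrite mul0r mulr_ge0.
  by apply: lcw; lia.
move: (al b) (al a) (be b) (be a) (al0 b) (al0 a) (be0 b) (be0 a) =>
  x y z t x0 y0 z0 t0.
have K1 := ler_wpM2l (mulr_ge0 x0 y0) H1.
have K2 := ler_wpM2l (mulr_ge0 x0 t0) H2.
have K3 := ler_wpM2l (mulr_ge0 z0 y0) H3.
have K4 := ler_wpM2l (mulr_ge0 z0 t0) H4.
have := lerD (lerD K1 K2) (lerD K3 K4).
set L := (X in X <= _ -> _); set M := (X in _ <= X -> _).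
by congr (_ <= _); rewrite /L /M; ring.
Qed.

(** * Inequalities between the first coefficients *)

Ltac nonneg := first [assumption | lazymatch goal with
  | |- is_true (0 <= _ + _) => apply: addr_ge0; nonneg
  | |- is_true (0 <= _ * _) => apply: mulr_ge0; nonneg
  | |- is_true (0 <= _ ^+ _) => apply: exprn_ge0; nonneg
  | |- is_true (0 <= 1) => exact: ler01
  | |- is_true (0 <= _%:R) => exact: ler0n end].

(** Here [u0], ..., [u3] are the first binomial weights of [s = t + 1] coins,
    written without denominators by means of [h = u0 / (6 q ^ 3)], and [w0],
    ..., [w6] are the first terms of the interleaved sequence after two coins.
    The hypothesis on [p] is [(s + 5) p >= 2], which enters as the
    nonnegativity of [E]; each difference is then [h ^ 2] times a polynomial in
    [p], [q], [t] and [E] with nonnegative coefficients. *)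
Lemma sharp_inequalities {F : realFieldType} (p h t : F)
    (q := 1 - p) (u0 := 6 * q ^+ 3 * h) (u1 := 6 * (t + 1) * p * q ^+ 2 * h)
    (u2 := 3 * (t + 1) * t * p ^+ 2 * q * h)
    (u3 := (t + 1) * t * (t - 1) * p ^+ 3 * h)
    (w0 := p ^+ 2 * u0) (w1 := p * u0 + q ^+ 2 * (u0 + u1))
    (w2 := p ^+ 2 * u1 + q * (u0 + u1) + p * q * u0)
    (w3 := p * u1 + p * q * (u0 + u1) + q ^+ 2 * u2)
    (w4 := (p ^+ 2 + q) * u2 + p * q * u1)
    (w5 := (p + p * q) * u2 + q ^+ 2 * u3)
    (w6 := (p ^+ 2 + q) * u3 + p * q * u2) :
    0 < p -> p < 1 -> 0 <= t -> 0 <= h -> 2 * q <= (t + 4) * p ->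
  [/\ (u1 + q * u0) * u3 <= u2 ^+ 2,
      w0 * w3 <= w1 * w2, w1 * w4 <= w2 * w3, w2 * w5 <= w3 * w4 &
      w3 * w6 <= w4 * w5].
Proof.
move=> p_gt0 p_lt1 t0 h0 hp.
have [p0 q0] : 0 <= p /\ 0 <= q by split; rewrite /q ?subr_ge0; exact: ltW.
pose E := (t + 4) * p - 2 * q; have E0 : 0 <= E by rewrite subr_ge0.
have i64 : 0 <= 64^-1 :> F by rewrite invr_ge0 ler0n.
have i128 : 0 <= 128^-1 :> F by rewrite invr_ge0 ler0n.
split; rewrite -subr_ge0.
- rewrite [X in 0 <= X](_ : _ = 64^-1 * (h ^+ 2 * t * p ^+ 3 * q ^+ 2 * (
      24 * E ^+ 2 + 39 * t * E ^+ 2 + 192 * q * E + 372 * q * t * E +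
      192 * q * t ^+ 2 * E + 672 * q ^+ 2 + 588 * q ^+ 2 * t +
      108 * p * t ^+ 2 * E + 144 * p ^+ 2 * t + 45 * p ^+ 2 * t ^+ 3)));
    last first.
    by rewrite /u0 /u1 /u2 /u3 ?/E /q; field.
  nonneg.
- rewrite [X in 0 <= X](_ : _ = h ^+ 2 * q ^+ 6 * (
      36 * q ^+ 4 + 180 * p * q ^+ 3 + 72 * p * q ^+ 3 * t +
      288 * p ^+ 2 * q ^+ 2 + 216 * p ^+ 2 * q ^+ 2 * t +
      36 * p ^+ 2 * q ^+ 2 * t ^+ 2 + 180 * p ^+ 3 * q +
      180 * p ^+ 3 * q * t + 36 * p ^+ 3 * q * t ^+ 2 + 36 * p ^+ 4 +
      54 * p ^+ 4 * t + 18 * p ^+ 4 * t ^+ 2)); last first.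
    by rewrite /w0 /w1 /w2 /w3 /u0 /u1 /u2 ?/E /q; field.
  nonneg.
- rewrite [X in 0 <= X](_ : _ = h ^+ 2 * p * q ^+ 4 * (
      36 * q ^+ 5 + 144 * p * q ^+ 4 + 72 * p * q ^+ 4 * t +
      216 * p ^+ 2 * q ^+ 3 + 252 * p ^+ 2 * q ^+ 3 * t +
      36 * p ^+ 2 * q ^+ 3 * t ^+ 2 + 180 * p ^+ 3 * q ^+ 2 +
      234 * p ^+ 3 * q ^+ 2 * t + 54 * p ^+ 3 * q ^+ 2 * t ^+ 2 +
      108 * p ^+ 4 * q + 180 * p ^+ 4 * q * t +
      72 * p ^+ 4 * q * t ^+ 2 + 36 * p ^+ 5 + 54 * p ^+ 5 * t +
      18 * p ^+ 5 * t ^+ 2)); last first.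
    by rewrite /w1 /w2 /w3 /w4 /u0 /u1 /u2 ?/E /q; field.
  nonneg.
- rewrite [X in 0 <= X](_ : _ = 64^-1 * (h ^+ 2 * p ^+ 3 * q ^+ 4 * (
      144 * q * E ^+ 2 + 192 * q * t * E ^+ 2 +
      81 * q * t ^+ 2 * E ^+ 2 + 1728 * q ^+ 2 * E +
      2184 * q ^+ 2 * t * E + 738 * q ^+ 2 * t ^+ 2 * E +
      192 * q ^+ 2 * t ^+ 3 * E + 5184 * q ^+ 3 + 5136 * q ^+ 3 * t +
      24 * p * t * E ^+ 2 + 48 * p * t ^+ 2 * E ^+ 2 +
      75 * p * q * t ^+ 3 * E + 120 * p * q ^+ 2 * t ^+ 3 +
      90 * p ^+ 2 * t ^+ 3 * E + 36 * p ^+ 2 * q * t ^+ 4 +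
      54 * p ^+ 3 * t ^+ 4))); last first.
    by rewrite /w2 /w3 /w4 /w5 /u0 /u1 /u2 /u3 ?/E /q; field.
  nonneg.
- rewrite [X in 0 <= X](_ : _ = 128^-1 * (h ^+ 2 * t * p ^+ 4 * q ^+ 2 * (
      372 * q ^+ 2 * E ^+ 2 + 549 * q ^+ 2 * t * E ^+ 2 +
      1680 * q ^+ 3 * E + 2256 * q ^+ 3 * t * E +
      384 * q ^+ 3 * t ^+ 2 * E + 336 * q ^+ 4 + 12 * q ^+ 4 * t +
      192 * p * q * E ^+ 2 + 372 * p * q * t * E ^+ 2 +
      414 * p * q ^+ 2 * t ^+ 2 * E + 48 * p ^+ 2 * E ^+ 2 +
      96 * p ^+ 2 * t * E ^+ 2 + 546 * p ^+ 2 * q * t ^+ 2 * E +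
      336 * p ^+ 2 * q ^+ 2 * t + 189 * p ^+ 2 * q ^+ 2 * t ^+ 3 +
      180 * p ^+ 3 * t ^+ 2 * E + 234 * p ^+ 3 * q * t ^+ 3 +
      108 * p ^+ 4 * t ^+ 3))); last first.
    by rewrite /w3 /w4 /w5 /w6 /u0 /u1 /u2 /u3 ?/E /q; field.
  nonneg.
Qed.

(** * A short tail: from [q ^ (s + 1) < p] to [(s + 5) p >= 2] *)

Lemma bernoulli_nat (x y n : nat) :
  (x ^ n * (x + n.+1 * y) <= (x + y) ^ n.+1)%N.
Proof.
elim: n => [|n IH]; first by rewrite !expn1 expn0 !mul1n.
rewrite [X in (_ <= X)%N]expnS.
apply: leq_trans (leq_mul (leqnn (x + y)) IH).
rewrite expnS mulnCA -mulnA mulnCA leq_mul2l; apply/orP; right; nia.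
Qed.

(** The quotient of the two sides is [2 / (s + 3)] times a power tending to
    [exp 2], and decreases from [s = 3] on: the step compares
    [(s + 6) (s + 3)] with [(s + 4) (s + 5)], which is larger by two. *)
Lemma bernoulli_growth (s : nat) : (2 * (s + 5) ^ s <= (s + 3) ^ s.+1)%N.
Proof.
case: s => [//|]; case=> [//|]; case=> [//|]; elim=> [//|n].
move: (n.+3) (isT : (3 <= n.+3)%N) => s s3 IH.
have pos : (0 < (s + 3) ^ s.+1 * (s + 5))%N by rewrite muln_gt0 expn_gt0 !addnS.
rewrite -(leq_pmul2r pos).
have key : (((s + 6) * (s + 3)) ^ s.+1 * (s + 5) <=
            ((s + 4) * (s + 5)) ^ s.+1 * (s + 4))%N.
  have -> : ((s + 4) * (s + 5) = (s + 6) * (s + 3) + 2)%N by lia.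
  apply: leq_trans (leq_mul (bernoulli_nat _ _ _) (leqnn _)).
  rewrite expnSr -!mulnA leq_mul2l; apply/orP; right; nia.
have -> : (s.+1 + 5 = s + 6)%N by lia.
have -> : (s.+1 + 3 = s + 4)%N by lia.
apply: (@leq_trans (2 * (((s + 4) * (s + 5)) ^ s.+1 * (s + 4)))).
  by rewrite -mulnA leq_mul2l /= mulnA -expnMn key.
have -> : (2 * (((s + 4) * (s + 5)) ^ s.+1 * (s + 4)) =
           (s + 4) ^ s.+2 * ((2 * (s + 5) ^ s) * (s + 5)))%N.
  rewrite expnMn [((s + 5) ^ s.+1)%N]expnSr [((s + 4) ^ s.+2)%N]expnSr.
  by move: ((s + 4) ^ s.+1)%N ((s + 5) ^ s)%N => x y; nia.
by rewrite leq_mul2l leq_mul2r IH !orbT.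
Qed.

(** If [p < 2 / (s + 5)] then [q > (s + 3) / (s + 5)], and [bernoulli_growth]
    makes the power of [q] too large. *)
Lemma few_tail_coins {F : realFieldType} (p : F) (s : nat) :
  0 < p -> p < 1 -> (1 - p) ^+ s.+1 < p -> 2 <= (s + 5)%:R * p.
Proof.
move=> p0 p1; apply: contraTT; rewrite -ltNge -leNgt => hp.
have c0 : 0 < (s + 5)%:R :> F by rewrite ltr0n addnS.
rewrite -(ler_pM2l (exprn_gt0 s.+1 c0)) -exprMn.
have le3 : (s + 3)%:R <= (s + 5)%:R * (1 - p).
  rewrite mulrBr mulr1 lerBrDr -lerBrDl -natrB; last lia.
  by rewrite subnDl; exact: ltW.
apply: (@le_trans _ _ ((s + 3)%:R ^+ s.+1)); last first.
  apply: lerXn2r => //; rewrite nnegrE ?ler0n //.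
  by apply: le_trans le3; rewrite ler0n.
apply: (@le_trans _ _ ((s + 5)%:R ^+ s * 2)).
  by rewrite exprSr -mulrA ler_wpM2l ?exprn_ge0 ?ler0n // ltW.
by rewrite -!natrX -natrM ler_nat mulnC bernoulli_growth.
Qed.

(** * Binomial weights *)

Definition binom_weight {F : realFieldType} (p : F) (s k : nat) : F :=
  'C(s, k)%:R * p ^+ k * (1 - p) ^+ (s - k).

Lemma binom_weight_gt0 {F : realFieldType} (p : F) (s k : nat) :
  0 < p -> p < 1 -> (0 < binom_weight p s k) = (k <= s)%N.
Proof.
move=> p0 p1; rewrite /binom_weight -mulrA pmulr_lgt0 ?ltr0n ?bin_gt0 //.
by rewrite mulr_gt0 // exprn_gt0 // subr_gt0.
Qed.

Lemma binom_weight_ge0 {F : realFieldType} (p : F) (s k : nat) :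
  0 < p -> p < 1 -> 0 <= binom_weight p s k.
Proof.
by move=> p0 p1; rewrite !mulr_ge0 ?exprn_ge0 ?ler0n ?subr_ge0 // ltW.
Qed.

Lemma binom_weight_small {F : realFieldType} (p : F) (s k : nat) :
  (s < k)%N -> binom_weight p s k = 0.
Proof. by move=> sk; rewrite /binom_weight bin_small ?mul0r. Qed.

(** With real subtraction the relation also covers [k = s], where both sides
    vanish, and [s < k], where both weights do. *)
Lemma binom_weight_ratio {F : realFieldType} (p : F) (s k : nat) :
  k.+1%:R * (1 - p) * binom_weight p s k.+1 =
  (s%:R - k%:R) * p * binom_weight p s k.
Proof.
have [sk|ks] := leqP s k.
  rewrite binom_weight_small //; case: (ltngtP s k) sk => // [sk|->] _.
    by rewrite binom_weight_small // !mulr0.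
  by rewrite subrr !mul0r mulr0.
have [e ->] : exists e, s = (k + e.+1)%N by exists (s - k.+1)%N; lia.
have -> : (k + e.+1)%:R - k%:R = e.+1%:R :> F by rewrite natrD addrC addKr.
rewrite /binom_weight.
have -> : (k + e.+1 - k.+1 = e)%N by lia.
have -> : (k + e.+1 - k = e.+1)%N by lia.
have bin_eq : k.+1%:R * 'C(k + e.+1, k.+1)%:R =
  e.+1%:R * 'C(k + e.+1, k)%:R :> F.
  by rewrite -!natrM mul_bin_left; congr (_ * _)%:R; lia.
rewrite !exprS.
transitivity (k.+1%:R * 'C(k + e.+1, k.+1)%:R *
  (p * p ^+ k * (1 - p) * (1 - p) ^+ e)); first by ring.
by rewrite bin_eq; ring.
Qed.

(** The ratio of consecutive weights decreases, so it may be compared at any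
    distance [j]. *)
Lemma binom_weight_log_concave {F : realFieldType} (p : F) (s k j : nat) :
    0 < p -> p < 1 ->
  binom_weight p s k * binom_weight p s (k + j).+1 <=
  binom_weight p s k.+1 * binom_weight p s (k + j).
Proof.
move=> p0 p1.
have [sk|ks] := ltnP s (k + j).+1.
  rewrite [binom_weight p s (k + j).+1]binom_weight_small // mulr0.
  by rewrite mulr_ge0 ?binom_weight_ge0.
have := binom_weight_ratio p s k; have := binom_weight_ratio p s (k + j).
have : 0 <= binom_weight p s k by exact: binom_weight_ge0.
have : 0 <= binom_weight p s (k + j) by exact: binom_weight_ge0.
move: (binom_weight p s k) (binom_weight p s k.+1).
move: (binom_weight p s (k + j)) (binom_weight p s (k + j).+1).
have [e ->] : exists e, s = (k + j + e.+1)%N by exists (s - (k + j).+1)%N; lia.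
have -> : (k + j + e.+1)%:R - (k + j)%:R = e.+1%:R :> F.
  by rewrite natrD addrC addKr.
have -> : (k + j + e.+1)%:R - k%:R = (j + e.+1)%:R :> F.
  by rewrite -addnA natrD addrC addKr.
move=> c d a b c0 a0 E2 E1.
have q0 : 0 < 1 - p by rewrite subr_gt0.
have pos : 0 < (k + j).+1%:R * (1 - p) * k.+1%:R by rewrite !mulr_gt0.
rewrite -(ler_pM2l pos).
have -> : (k + j).+1%:R * (1 - p) * k.+1%:R * (a * d) =
  k.+1%:R * e.+1%:R * (p * a * c).
  transitivity ((k + j).+1%:R * (1 - p) * d * (k.+1%:R * a)); first by ring.
  by rewrite E2; ring.
have -> : (k + j).+1%:R * (1 - p) * k.+1%:R * (b * c) =
  (k + j).+1%:R * (j + e.+1)%:R * (p * a * c).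
  transitivity (k.+1%:R * (1 - p) * b * ((k + j).+1%:R * c)); first by ring.
  by rewrite E1; ring.
rewrite ler_wpM2r //; first by rewrite !mulr_ge0 // ltW.
by rewrite -!natrM ler_nat leq_mul //; lia.
Qed.

(** * The law of the number of errors *)

(** The interleaved laws before any of the coins up to label [m]: after a top
    card the errors are the top cards of the tail; after a bottom card a tail
    without top cards costs one error as well, that of card [n], which moves
    the weight at 0 to 1. *)
Definition tail_weight {F : realFieldType} (p : F) (s d : nat) : F :=
  if odd d then
    if d./2 is 0%N then binom_weight p s 0 + binom_weight p s 1
    else binom_weight p s d./2.+1
  else binom_weight p s d./2.

Definition error_weight {F : realFieldType} (p : F) (s m : nat) : nat -> F :=
  iter m (coin_step p) (tail_weight p s).

Lemma error_weight_ge0 {F : realFieldType} (p : F) (s m d : nat) :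
  0 < p -> p < 1 -> 0 <= error_weight p s m d.
Proof.
move=> p0 p1; elim: m d => [|m IH] d /=; last exact: coin_step_ge0.
rewrite /tail_weight; case: odd; last exact: binom_weight_ge0.
by case: (d./2) => [|k]; rewrite ?addr_ge0 ?binom_weight_ge0.
Qed.

Lemma error_weight_initial_support {F : realFieldType} (p : F) (s m : nat) :
  0 < p -> p < 1 -> initial_support (error_weight p s m).
Proof.
move=> p0 p1; elim: m => [|m IH] /=; last first.
  by apply: coin_step_initial_support => // d; exact: error_weight_ge0.
move=> d; rewrite /tail_weight /= uphalf_half.
case: (odd d) => /=; rewrite ?add0n ?add1n.
  case: (d./2) => [|k]; rewrite !binom_weight_gt0 // => s1.
  by rewrite ltr_pwDl ?binom_weight_gt0 ?binom_weight_ge0.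
case: (d./2) => [|k]; rewrite !binom_weight_gt0 //.
exact: ltnW.
Qed.

Lemma error_weight_step {F : realFieldType} (p : F) (s m : nat) :
  skip_log_concave (error_weight p s m) -> 0 < p -> p < 1 ->
  skip_log_concave (error_weight p s m.+1).
Proof.
by move=> lc p0 p1; apply: coin_step_skip_log_concave => // d;
  exact: error_weight_ge0.
Qed.

Lemma error_weight_no_tail {F : realFieldType} (p : F) (m : nat) :
  0 < p -> p < 1 -> skip_log_concave (error_weight p 0 m).
Proof.
move=> p0 p1; elim: m => [|m IH]; last exact: error_weight_step.
move=> a b _; rewrite [X in _ * X <= _](_ : _ = 0); last first.
  rewrite /= /tail_weight /= negbK; case: odd; exact: binom_weight_small.
by rewrite mulr0 mulr_ge0 ?error_weight_ge0.
Qed.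

Lemma error_weight2E {F : realFieldType} (p : F) (s : nat) (q := 1 - p)
    (u := binom_weight p s) (w := error_weight p s 2) :
  [/\ w 0%N = p ^+ 2 * u 0%N, w 1%N = p * u 0%N + q ^+ 2 * (u 0%N + u 1%N),
      w 2%N = p ^+ 2 * u 1%N + q * (u 0%N + u 1%N) + p * q * u 0%N &
      w 3%N = p * u 1%N + p * q * (u 0%N + u 1%N) + q ^+ 2 * u 2%N].
Proof.
rewrite /w /u /q /error_weight /= /coin_step /= /tail_weight /=.
by split; ring.
Qed.

(** From index 4 on the modified coefficients of [tail_weight] are out of
    reach, and only binomial weights remain. *)
Lemma error_weight2_evenE {F : realFieldType} (p : F) (s k : nat) (q := 1 - p)
    (u := binom_weight p s) :
  error_weight p s 2 k.*2.+4 = (p ^+ 2 + q) * u k.+2 + p * q * u k.+1.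
Proof.
rewrite /error_weight /= /coin_step /= /tail_weight /= !negbK.
rewrite odd_double /= doubleK uphalf_double /u /q; ring.
Qed.

Lemma error_weight2_oddE {F : realFieldType} (p : F) (s k : nat) (q := 1 - p)
    (u := binom_weight p s) :
  error_weight p s 2 k.*2.+1.+4 = (p + p * q) * u k.+2 + q ^+ 2 * u k.+3.
Proof.
rewrite /error_weight /= /coin_step /= /tail_weight /= !negbK.
rewrite odd_double /= doubleK uphalf_double /u /q; ring.
Qed.

Lemma first_binom_weights {F : realFieldType} (p : F) (s : nat) (t := s%:R)
    (q := 1 - p) (u := binom_weight p s.+1) (h := u 0%N / (6 * q ^+ 3)) :
    0 < p -> p < 1 ->
  [/\ u 0%N = 6 * q ^+ 3 * h, u 1%N = 6 * (t + 1) * p * q ^+ 2 * h,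
      u 2%N = 3 * (t + 1) * t * p ^+ 2 * q * h &
      u 3%N = (t + 1) * t * (t - 1) * p ^+ 3 * h].
Proof.
move=> p0 p1.
have q0 : q != 0 by rewrite subr_eq0 gt_eqF.
have E0 : u 0%N = 6 * q ^+ 3 * h by rewrite /h; field.
have E1 : u 1%N = 6 * (t + 1) * p * q ^+ 2 * h.
  have := binom_weight_ratio p s.+1 0;
    rewrite -/u -/q E0 subr0 mul1r -[s.+1%:R]natr1 => H.
  by apply: (mulfI q0); rewrite H -/t; ring.
have E2 : u 2%N = 3 * (t + 1) * t * p ^+ 2 * q * h.
  have := binom_weight_ratio p s.+1 1;
    rewrite -/u -/q E1 -[s.+1%:R]natr1 -/t => H.
  have q2 : 2 * q != 0 by rewrite mulf_neq0 // pnatr_eq0.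
  by apply: (mulfI q2); rewrite H; ring.
split=> //.
have := binom_weight_ratio p s.+1 2;
  rewrite -/u -/q E2 -[s.+1%:R]natr1 -/t => H.
have q3 : 3 * q != 0 by rewrite mulf_neq0 // pnatr_eq0.
by apply: (mulfI q3); rewrite H; ring.
Qed.

Lemma short_tail_inequalities {F : realFieldType} (p : F) (s : nat)
    (q := 1 - p) (u := binom_weight p s.+1) (w := error_weight p s.+1 2) :
    0 < p -> p < 1 -> q ^+ s.+2 < p ->
  [/\ (u 1%N + q * u 0%N) * u 3%N <= u 2%N ^+ 2,
      w 0%N * w 3%N <= w 1%N * w 2%N, w 1%N * w 4%N <= w 2%N * w 3%N,
      w 2%N * w 5%N <= w 3%N * w 4%N & w 3%N * w 6%N <= w 4%N * w 5%N].
Proof.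
rewrite /w /u /q {w u q} => p0 p1 hp; have q0 : 0 < 1 - p by rewrite subr_gt0.
have := few_tail_coins _ _ p0 p1 hp; rewrite addSnnS natrD => bound.
have bound' : 2 * (1 - p) <= (s%:R + 4) * p by lra.
have h0 : 0 <= binom_weight p s.+1 0 / (6 * (1 - p) ^+ 3).
  by rewrite divr_ge0 ?binom_weight_ge0 // mulr_ge0 ?ler0n ?exprn_ge0 // ltW.
have := sharp_inequalities p _ s%:R p0 p1 (ler0n _ _) h0 bound'.
have [<- <- <- <-] := first_binom_weights p s p0 p1.
have [-> -> -> ->] := error_weight2E p s.+1.
have w4 := error_weight2_evenE p s.+1 0.
have w5 := error_weight2_oddE p s.+1 0.
have w6 := error_weight2_evenE p s.+1 1.
by rewrite !doubleS double0 in w4 w5 w6; rewrite w4 w5 w6.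
Qed.

(** The inequalities at the first four indices are those above; beyond them
    only binomial weights occur, and each difference is a nonnegative
    combination of their log-concavity defects. *)
Lemma error_weight2_skip_log_concave {F : realFieldType} (p : F) (s : nat) :
    0 < p -> p < 1 -> (1 - p) ^+ s.+2 < p ->
  skip_log_concave (error_weight p s.+1 2).
Proof.
move=> p0 p1 hp; apply: skip_log_concave_local.
- by move=> d; exact: error_weight_ge0.
- exact: error_weight_initial_support.
have [_ w03 w14 w25 w36] := short_tail_inequalities p s p0 p1 hp.
do 4!case=> //; move=> a.
have [k Ea] : exists k, a = k.*2.+1 \/ a = k.*2.
  exists a./2; rewrite -{1 3}(odd_double_half a).
  by case: odd; [left | right].
have ev j := error_weight2_evenE p s.+1 j.
have od j := error_weight2_oddE p s.+1 j.
have LC1 := binom_weight_log_concave p s.+1 k.+1 1 p0 p1.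
have LC2 := binom_weight_log_concave p s.+1 k.+2 1 p0 p1.
have LC3 := binom_weight_log_concave p s.+1 k.+1 2 p0 p1.
rewrite !addn1 ?addn2 in LC1 LC2 LC3.
have [p0' q0] : 0 <= p /\ 0 <= 1 - p by rewrite subr_ge0 !ltW.
have := (ev k, ev k.+1, ev k.+2, od k, od k.+1).
rewrite !doubleS => -[[[[ev0 ev1] ev2] od0] od1].
case: Ea => ->; rewrite ?ev0 ?ev1 ?ev2 ?od0 ?od1 {ev ev0 ev1 ev2 od od0 od1}.
all: move: LC1 LC2 LC3.
all: move: (binom_weight p s.+1 k.+1) (binom_weight p s.+1 k.+2).
all: move: (binom_weight p s.+1 k.+3) (binom_weight p s.+1 k.+4).
all: move=> a3 a4 a1 a2; rewrite -subr_ge0 => LC1.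
all: rewrite -subr_ge0 => LC2; rewrite -subr_ge0 => LC3; rewrite -subr_ge0.
  have := mulr_ge0 p0' LC2.
  by congr (_ <= _); ring.
have c1 : 0 <= p ^+ 2 * (1 - p) * (1 + (1 - p)) by nonneg.
have c2 : 0 <= (p ^+ 2 + (1 - p)) * (1 - p) ^+ 2 by nonneg.
have c3 : 0 <= p * (1 - p) ^+ 3 by nonneg.
have := addr_ge0 (addr_ge0 (mulr_ge0 c1 LC1) (mulr_ge0 c2 LC2))
  (mulr_ge0 c3 LC3).
by congr (_ <= _); ring.
Qed.

(** After one coin, [U] is binomial except for its first two coefficients, and
    the interleaved condition may fail; only the comparison involving the second
    of these coefficients and the third weight needs a short tail. *)
Lemma error_weight1_log_concave {F : realFieldType} (p : F) (s k : nat) :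
    0 < p -> p < 1 -> (1 - p) ^+ s.+2 < p ->
  error_weight p s.+1 1 k.*2 * error_weight p s.+1 1 k.*2.+4 <=
  error_weight p s.+1 1 k.*2.+2 ^+ 2.
Proof.
move=> p0 p1 hp; have [u03 _ _ _ _] := short_tail_inequalities p s p0 p1 hp.
have w0 : error_weight p s.+1 1 0 = p * binom_weight p s.+1 0.
  by rewrite /= /coin_step /tail_weight /=; ring.
have w2 : error_weight p s.+1 1 2 =
    binom_weight p s.+1 1 + (1 - p) * binom_weight p s.+1 0.
  by rewrite /= /coin_step /tail_weight /=; ring.
have w4 j : error_weight p s.+1 1 j.*2.+4 = binom_weight p s.+1 j.+2.
  rewrite /= /coin_step /tail_weight /= !negbK odd_double /= doubleK.
  by rewrite uphalf_double; ring.
have LC j : binom_weight p s.+1 j * binom_weight p s.+1 j.+2 <=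
    binom_weight p s.+1 j.+1 ^+ 2.
  by have := binom_weight_log_concave p s.+1 j 1 p0 p1; rewrite addn1 expr2.
have u0 j : 0 <= binom_weight p s.+1 j by exact: binom_weight_ge0.
case: k => [|[|k]].
- have := w4 0%N; rewrite double0 w0 w2 => ->.
  have := LC 0%N; have := u0 0%N; have := u0 1%N; have := u0 2%N.
  move: (binom_weight _ _ 0) (binom_weight _ _ 1) (binom_weight _ _ 2).
  move=> a b c c0 b0 a0 acb.
  apply: (@le_trans _ _ (a * c)); first by rewrite ler_wpM2r // ler_piMl // ltW.
  have qa0 : 0 <= (1 - p) * a by rewrite mulr_ge0 // subr_ge0 ltW.
  apply: (le_trans acb); rewrite lerXn2r ?nnegrE ?addr_ge0 //.
  by rewrite lerDl.
- have := w4 0%N; rewrite double0 => w4'.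
  by have := w4 1%N; rewrite !doubleS double0 w2 w4' => ->.
have := w4 k.+1; have := w4 k.+2; rewrite !doubleS w4 => -> ->; exact: LC.
Qed.

Lemma error_weight_log_concave {F : realFieldType} (p : F) (s m k : nat) :
    0 < p -> p < 1 -> m = 0%N \/ (1 - p) ^+ s.+1 < p \/ s = 0%N ->
  error_weight p s m k.*2 * error_weight p s m k.*2.+4 <=
  error_weight p s m k.*2.+2 ^+ 2.
Proof.
move=> p0 p1 short.
have even_lc w :
    skip_log_concave w -> w k.*2 * w k.*2.+4 <= w k.*2.+2 ^+ 2 :> F.
  by move=> lc; rewrite expr2; apply: lc; lia.
case: s short => [|s] short; first exact/even_lc/error_weight_no_tail.
case: m short => [|m] short.
  rewrite /= /tail_weight /= !negbK odd_double /= doubleK.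
  by have := binom_weight_log_concave p s.+1 k 1 p0 p1; rewrite addn1 expr2.
case: short => // -[] // hp.
case: m => [|m]; first exact: error_weight1_log_concave.
apply: even_lc; elim: m => [|m IH]; last exact: error_weight_step.
exact: error_weight2_skip_log_concave.
Qed.

(** * The number of errors as a function of the coins *)

Definition cutoff {R : realType} (p : R) : nat := `|nu p|%N.

Lemma cutoff_gt0 {R : realType} (p : R) :
  0 < p -> p < 1 -> nu p = cutoff p /\ (0 < cutoff p)%N.
Proof.
move=> p0 p1; suff : (0 < nu p)%R by rewrite /cutoff; lia.
rewrite /nu; case: ifP => // _;
  suff : (0 <= Num.floor (ln p / ln (1 - p)))%R by lia.
rewrite floor_ge0; apply: mulr_le0; first by rewrite ln_le0 // ltW.
by rewrite invr_le0 ln_le0 // lerBlDr lerDl ltW.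
Qed.

Lemma cutoff_large_p {R : realType} (p : R) : 2^-1 <= p -> cutoff p = 1%N.
Proof. by rewrite /cutoff /nu => ->. Qed.

(** The floor defining [nu] rounds [ln p / ln q] down, so one more factor [q]
    brings the power below [p]. *)
Lemma cutoff_small_p {R : realType} (p : R) :
  0 < p -> p < 2^-1 -> (1 - p) ^+ cutoff p < p.
Proof.
move=> p0 ph; have p1 : p < 1 by lra.
have q0 : 0 < 1 - p by lra.
have lnq : ln (1 - p) < 0 by apply: ln_lt0; rewrite q0 /=; lra.
rewrite -ltr_ln ?posrE ?exprn_gt0 // lnXn //.
have [nuE _] := cutoff_gt0 p p0 p1.
rewrite -mulr_natr mulrC -ltr_ndivrMr //.
rewrite -[X in _ < X](_ : (nu p)%:~R = _ ); last by rewrite nuE.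
by rewrite /nu leNgt ph /= floorD1_gt.
Qed.

(** For [p >= 1/2] the cutoff is 1, and switching to [n] when [n <= j + 1]
    changes nothing: then [j + 1] is [n]. *)
Lemma guess_before_reveal {R : realType} (p : R) (n : nat) (shown : seq nat)
    (j := last 0%N shown) :
    0 < p -> p < 1 -> n \notin shown -> n.-1 \notin shown -> (j < n)%N ->
  optimal_strategy p n shown = if (n <= j + cutoff p)%N then n else j.+1.
Proof.
move=> p0 p1 nn nn1 jn; rewrite /optimal_strategy (negbTE nn) (negbTE nn1) /=
  -/j.
case: ifP => [/cutoff_large_p ->|_].
  by rewrite addn1; case: ifP => //; lia.
have [-> _] := cutoff_gt0 p p0 p1.
by congr (if _ then _ else _); lia.
Qed.

(** The cards left are the ones not shown, and the first of a decreasing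
    sequence is their maximum. *)
Lemma correct_after_reveal {R : realType} (p : R) (n : nat)
    (shown deck : seq nat) :
    (n \in shown) || (n.-1 \in shown) -> sorted gtn deck ->
    perm_eq (shown ++ deck) (iota 1 n) ->
  correct_guesses (optimal_strategy p n) shown deck = size deck.
Proof.
elim: deck shown => [//|c deck IH] shown rev_n sorted_deck perm /=.
rewrite IH ?(path_sorted sorted_deck) ?cat_rcons //; last first.
  by rewrite !mem_rcons !inE; case/orP: rev_n => ->; rewrite !orbT.
rewrite -[RHS]add1n; congr (_ + _)%N.
suff -> : optimal_strategy p n shown = c by rewrite eqxx.
rewrite /optimal_strategy rev_n.
have uniq_all : uniq (shown ++ c :: deck) by rewrite (perm_uniq perm) iota_uniq.
have mem_c : (0 < c < n.+1)%N.
  have := perm_mem perm c; rewrite mem_iota mem_cat inE eqxx orbT => /esym.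
  by lia.
have cshown : c \notin shown.
  by move: uniq_all; rewrite cat_uniq /= negb_or => /and3P[_ /andP[]].
apply/eqP; rewrite eqn_leq; apply/andP; split; last first.
  by rewrite (big_rem c) ?mem_index_iota //= cshown leq_maxl.
apply/bigmax_leqP_seq => i; rewrite mem_index_iota => i_n i_shown.
have := perm_mem perm i; rewrite mem_iota mem_cat (negbTE i_shown) inE /=.
have -> : (0 < i < 1 + n)%N by lia.
case/orP => [/eqP -> //|i_deck].
have tr : transitive gtn by move=> y x z yx zy; exact: ltn_trans zy yx.
exact: ltnW (allP (order_path_min tr sorted_deck) i i_deck).
Qed.

(** The coins [bs] belong to the labels that follow the current one, [m] is the
    number of those labels for which the player still guesses the next label,
    and [b] tells whether the current card went to the top. *)
Fixpoint errors (b : bool) (m : nat) (bs : seq bool) : nat :=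
  if m is m'.+1 then
    if bs is c :: bs' then ((~~ b && c) + errors c m' bs')%N else 0%N
  else (count id bs + (~~ b && ~~ has id bs))%N.

(** The labels up to [j] are decided.  Once [j] has passed the switching point,
    any guess made while top cards remain is wrong: it is [n], or the successor
    of a label already too small.  Card [n] itself is guessed unless the last
    top card came before the switching point. *)
Lemma errors_near_bottom {R : realType} (p : R) (n j : nat) (bs : seq bool)
    (shown bottom : seq nat) (l := last 0%N shown)
    (deck := mask bs (iota j.+1 (size bs)) ++ n :: bottom) :
    0 < p -> p < 1 -> (j + size bs).+1 = n -> (n - cutoff p <= j)%N ->
    (l <= j)%N -> all (leq^~ l) shown -> sorted gtn (n :: bottom) ->
    perm_eq (shown ++ deck) (iota 1 n) ->
  (correct_guesses (optimal_strategy p n) shown deck +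
   (count id bs + ((l < n - cutoff p) && ~~ has id bs)) = size deck)%N.
Proof.
move=> p0 p1; have [_ cut0] := cutoff_gt0 p p0 p1.
elim: bs j shown @l @deck =>
  [|c bs IH] j shown l deck sz mj lj shown_l srt perm.
  rewrite addn0 in sz; rewrite /deck /= add0n andbT in perm *.
  have nshown : n \notin shown.
    by apply/negP => /(allP shown_l) /=; lia.
  have after : correct_guesses (optimal_strategy p n) (rcons shown n) bottom =
    size bottom.
    apply: correct_after_reveal; rewrite ?cat_rcons ?mem_rcons ?inE ?eqxx //.
    exact: path_sorted srt.
  rewrite after.
  have [n1shown|n1shown] := boolP (n.-1 \in shown).
    have n1l : (n.-1 <= l)%N := allP shown_l _ n1shown.
    have := correct_after_reveal p n shown (n :: bottom).
    rewrite n1shown orbT /= after => -> //.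
    by rewrite ltnNge (leq_trans mj) ?addn0 //; lia.
  rewrite guess_before_reveal // -/l; last lia.
  have -> : (n <= l + cutoff p)%N = (n - cutoff p <= l)%N by lia.
  case: leqP => lm /=; first by rewrite eqxx; lia.
  have -> : (l.+1 == n) = false by lia.
  by lia.
rewrite /= in sz.
case: c => /= in deck perm *; last by apply: IH => //; lia.
have ns x : (j < x)%N -> x \notin shown.
  by move=> jx; apply/negP => /(allP shown_l) /=; lia.
have guess : (optimal_strategy p n shown == j.+1) = false.
  rewrite guess_before_reveal ?ns // -/l; try lia.
  by case: ifP; lia.
rewrite /deck /= guess add0n.
have := IH j.+1 (rcons shown j.+1); cbv zeta;
  rewrite last_rcons all_rcons leqnn cat_rcons /=.
have -> : (j.+1 < n - cutoff p)%N = false by lia.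
rewrite andbF => <- //; try lia.
by apply/allP => x /(allP shown_l) /=; lia.
Qed.

(** Before the switching point the guess is [l + 1], where [l] is the last top
    card; among the labels after [j] it can only hit [j + 1], and does so when
    [l = j] and card [j + 1] is a top card. *)
Lemma errors_far_from_bottom {R : realType} (p : R) (n j d : nat)
    (bs : seq bool) (shown bottom : seq nat) (l := last 0%N shown)
    (deck := mask bs (iota j.+1 (size bs)) ++ n :: bottom) :
    0 < p -> p < 1 -> (j + size bs).+1 = n -> (n - cutoff p = j + d)%N ->
    (l <= j)%N -> all (leq^~ l) shown -> sorted gtn (n :: bottom) ->
    perm_eq (shown ++ deck) (iota 1 n) ->
  (correct_guesses (optimal_strategy p n) shown deck +
   errors (l == j) d bs = size deck)%N.
Proof.
move=> p0 p1; have [_ cut0] := cutoff_gt0 p p0 p1.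
elim: d bs j shown @l @deck =>
  [|d IH] bs j shown l deck sz mj lj shown_l srt perm.
  rewrite addn0 in mj.
  have := errors_near_bottom p n j bs shown bottom p0 p1 sz _ lj shown_l srt
    perm.
  rewrite mj leqnn => <- //=.
  by rewrite -/l ltn_neqAle lj andbT.
rewrite /deck in perm *; clear deck.
case: bs sz perm => [|c bs] sz perm; rewrite /= in sz; first by lia.
case: c => /= in perm *; last first.
  rewrite andbF add0n -[false](_ : (l == j.+1) = false); last by lia.
  by apply: IH => //; lia.
have ns x : (j < x)%N -> x \notin shown.
  by move=> jx; apply/negP => /(allP shown_l) /=; lia.
have guess : optimal_strategy p n shown = l.+1.
  rewrite guess_before_reveal ?ns // -/l; try lia.
  by case: ifP => //; lia.
rewrite guess eqSS andbT.
have := IH bs j.+1 (rcons shown j.+1); cbv zeta;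
  rewrite last_rcons all_rcons leqnn eqxx cat_rcons /=.
move=> <- //; try lia.
by apply/allP => x /(allP shown_l) /=; lia.
Qed.

Lemma perm_mask_negb (T : eqType) (bs : seq bool) (s : seq T) :
  size bs = size s -> perm_eq (mask bs s ++ mask (map negb bs) s) s.
Proof.
elim: bs s => [|c bs IH] [|x s] //= [sz].
case: c => /=; first by rewrite perm_cons IH.
by rewrite -[x :: mask _ _]cat1s perm_catCA perm_cons IH.
Qed.

Lemma shuffle_mask (n : nat) (eps : coins n.+1)
    (bs := take n [seq eps i | i <- enum 'I_n.+1]) :
  size bs = n /\
  shuffle eps =
    mask bs (iota 1 n) ++ n.+1 :: rev (mask (map negb bs) (iota 1 n)).
Proof.
have bsE : bs = [seq eps (widen_ord (leqnSn n) i) | i <- enum 'I_n].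
  by rewrite /bs enum_ordSr map_rcons -map_comp -cats1 take_size_cat //
    size_map size_enum_ord.
split; first by rewrite bsE size_map size_enum_ord.
have sel (P : pred 'I_n.+1) :
    [seq (val i).+1 | i <- enum 'I_n.+1 & (i != ord_max) && P i] =
    mask [seq P (widen_ord (leqnSn n) i) | i <- enum 'I_n] (iota 1 n).
  rewrite enum_ordSr filter_rcons eqxx /=
    filter_map -map_comp filter_mask map_mask.
  congr mask.
    by apply: eq_map => i /=; rewrite -val_eqE /= neq_ltn ltn_ord.
  rewrite -[1%N]addn0 iotaDl -val_enum_ord -map_comp.
  by apply: eq_map => i.
by rewrite shuffleE (sel eps) (sel (fun i => ~~ eps i)) bsE -map_comp.
Qed.

(** Before the first guess the last label counts as 0, hence as equal to the
    number of decided labels: the initial state is that of a top card. *)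
Lemma num_correctE {R : realType} (p : R) (n : nat) (eps : coins n.+1)
    (bs := take n [seq eps i | i <- enum 'I_n.+1]) :
    0 < p -> p < 1 ->
  (num_correct p eps + errors true (n.+1 - cutoff p) bs = n.+1)%N.
Proof.
move=> p0 p1; have [sz shE] := shuffle_mask n eps; rewrite -/bs in sz shE.
have perm : perm_eq (shuffle eps) (iota 1 n.+1).
  rewrite shE -[n.+1]addn1 iotaD -cat1s perm_catCA perm_sym perm_catC perm_sym.
  rewrite add1n addn1 perm_cat2l.
  apply: perm_trans (perm_mask_negb _ bs (iota 1 n) _);
    last by rewrite size_iota.
  by rewrite perm_cat2l perm_rev.
have sorted_rest : sorted gtn (n.+1 :: rev (mask (map negb bs) (iota 1 n))).
  rewrite -rev_rcons rev_sorted.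
  rewrite -(_ : mask (rcons (map negb bs) true) (iota 1 n.+1) =
    rcons (mask (map negb bs) (iota 1 n)) n.+1).
    by apply: sorted_mask; [exact: ltn_trans | exact: iota_ltn_sorted].
  by rewrite -[n.+1]addn1 iotaD -!cats1 mask_cat ?size_map ?size_iota //=
    add1n addn1.
have [_ cut0] := cutoff_gt0 p p0 p1.
have := errors_far_from_bottom p n.+1 0 (n.+1 - cutoff p) bs [::] _
  p0 p1 _ _ _ _ sorted_rest.
rewrite /= sz -shE (perm_size perm) size_iota /num_correct; apply => //.
Qed.

(** * Averaging over the coins *)

Fixpoint coin_avg {R : realType} (p : R) (n : nat) (f : seq bool -> R) : R :=
  if n is n'.+1 then
    p * coin_avg p n' (fun bs => f (true :: bs)) +
    (1 - p) * coin_avg p n' (fun bs => f (false :: bs))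
  else f [::].

Lemma eq_coin_avg {R : realType} (p : R) (n : nat) (f g : seq bool -> R) :
  f =1 g -> coin_avg p n f = coin_avg p n g.
Proof.
by elim: n f g => [|n IH] f g fg //=; congr (_ * _ + _ * _); apply: IH => bs.
Qed.

Lemma coin_avgD {R : realType} (p : R) (n : nat) (f g : seq bool -> R) :
  coin_avg p n (fun bs => f bs + g bs) = coin_avg p n f + coin_avg p n g.
Proof. by elim: n f g => [|n IH] f g //=; rewrite !IH; ring. Qed.

Lemma coin_avg0 {R : realType} (p : R) (n : nat) : coin_avg p n (fun=> 0) = 0.
Proof. by elim: n => [|n IH] //=; rewrite !IH !mulr0 addr0. Qed.

(** The coin of card [n], which is placed on an empty pile, averages out. *)
Lemma coin_avg_take {R : realType} (p : R) (n : nat) (f : seq bool -> R) :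
  coin_avg p n.+1 (fun bs => f (take n bs)) = coin_avg p n f.
Proof.
elim: n f => [|n IH] f; first by rewrite /=; ring.
rewrite -[RHS]/(p * coin_avg p n (fun bs => f (true :: bs)) +
  (1 - p) * coin_avg p n (fun bs => f (false :: bs))).
by rewrite -(IH (fun bs => f (true :: bs))) -(IH (fun bs => f (false :: bs))).
Qed.

(** Splitting off the first coin, by the bijection between [coins n.+1] and
    [bool * coins n], is the recursion defining [coin_avg]. *)
Lemma sum_coins {R : realType} (p : R) (n : nat) (f : seq bool -> R) :
  \sum_(eps : coins n) coins_prob p eps * f [seq eps i | i <- enum 'I_n] =
  coin_avg p n f.
Proof.
elim: n f => [|n IH] f.
  rewrite (big_pred1 [ffun=> true]); last first.
    by move=> e; apply/esym/eqP/ffunP => -[].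
  rewrite /coins_prob big_ord0 mul1r /=; congr f.
  by apply: size0nil; rewrite size_map size_enum_ord.
pose join (c : bool * coins n) : coins n.+1 :=
  [ffun i => if unlift ord0 i is Some j then c.2 j else c.1].
pose split (e : coins n.+1) : bool * coins n :=
  (e ord0, [ffun j => e (lift ord0 j)]).
have joinK : cancel join split.
  move=> [b e]; rewrite /split /join ffunE unlift_none; congr pair.
  by apply/ffunP => j; rewrite !ffunE liftK.
have splitK : cancel split join.
  move=> e; apply/ffunP => i; rewrite ffunE /=.
  by case: unliftP => [j ->|->]; rewrite ?ffunE.
rewrite (reindex join) /=; last by exists split => ? _.
rewrite -(pair_big predT predT (fun b e => coins_prob p (join (b, e)) *
  f [seq join (b, e) i | i <- enum 'I_n.+1])) /=.
have joinE b e : coins_prob p (join (b, e)) *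
      f [seq join (b, e) i | i <- enum 'I_n.+1] =
    (if b then p else 1 - p) *
      (coins_prob p e * f (b :: [seq e i | i <- enum 'I_n])).
  rewrite mulrA; congr (_ * f _).
    rewrite /coins_prob big_ord_recl ffunE unlift_none; congr (_ * _).
    by apply: eq_bigr => i _; rewrite ffunE liftK.
  rewrite enum_ordSl /= ffunE unlift_none -map_comp; congr cons.
  by apply: eq_map => i /=; rewrite ffunE liftK.
rewrite big_bool /= -!IH !mulr_sumr.
by congr (_ + _); apply: eq_bigr => e _; exact: joinE.
Qed.

Lemma coin_avg_count {R : realType} (p : R) (s k : nat) :
  coin_avg p s (fun bs => (count id bs == k)%:R) = binom_weight p s k.
Proof.
elim: s k => [|s IH] k.
  by case: k => [|k]; rewrite /binom_weight /=
    ?bin0n //= ?mul0r ?mulr1 ?expr0 ?mulr1.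
have shift (b : bool) : coin_avg p s (fun bs => (count id (b :: bs) == k)%:R) =
   if b then if k is k'.+1 then binom_weight p s k' else 0
   else binom_weight p s k.
  case: b => /=; last exact: IH.
  case: k => [|k]; last exact: IH.
  exact: coin_avg0.
rewrite -[LHS]/(p * coin_avg p s (fun bs => (count id (true :: bs) == k)%:R) +
  (1 - p) * coin_avg p s (fun bs => (count id (false :: bs) == k)%:R)) !shift.
case: k {shift} => [|k].
  by rewrite /binom_weight !bin0 !subn0 exprS; ring.
have [sk|ks] := leqP s k.
  rewrite [binom_weight p s k.+1]binom_weight_small //.
  case: (ltngtP s k) sk => // [sk|->] _;
    first by rewrite !binom_weight_small // ?mulr0 ?addr0 //; lia.
  by rewrite /binom_weight !binn !subnn exprS; ring.
rewrite /binom_weight binS natrD subSS.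
have -> : (s - k = (s - k.+1).+1)%N by lia.
by rewrite !exprS; ring.
Qed.

(** The law of [errors] in its two states obeys the recursion of [coin_step]:
    the interleaving index is twice the number of errors, less one after a
    bottom card, a state in which at least one error is to come. *)
Lemma coin_avg_errors {R : realType} (p : R) (s m e : nat) (b : bool) :
  coin_avg p (m + s) (fun bs => (errors b m bs == e)%:R) =
  if b then error_weight p s m e.*2
  else if e is e'.+1 then error_weight p s m e'.*2.+1 else 0.
Proof.
elim: m b e => [|m IH] b e.
  case: b => /=.
    rewrite -[RHS]/(tail_weight p s e.*2) /tail_weight odd_double doubleK
      -coin_avg_count.
    by apply: eq_coin_avg => bs; rewrite addn0.
  under eq_coin_avg => bs do rewrite has_count -leqNgt leqn0.
  case: e => [|e].
    rewrite -[RHS](coin_avg0 p s); apply: eq_coin_avg => bs.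
    by case: count.
  rewrite -[RHS]/(tail_weight p s e.*2.+1) /tail_weight /= odd_double /=
    uphalf_double.
  case: e => [|e]; rewrite -!coin_avg_count -?coin_avgD;
    apply: eq_coin_avg => bs.
    by case: count => [|[|k]] /=; rewrite ?addr0 ?add0r.
  by case: count => [|c] //=; rewrite addn0.
rewrite addSn [LHS]/=.
have tl c : coin_avg p (m + s)
      (fun bs => ((~~ b && c) + errors c m bs == e)%N%:R) =
    if ~~ b && c then
      if e is e'.+1 then coin_avg p (m + s) (fun bs => (errors c m bs == e')%:R)
      else 0
    else coin_avg p (m + s) (fun bs => (errors c m bs == e)%:R).
  case: ifP => _ //; case: e => [|e]; first exact: coin_avg0.
  by apply: eq_coin_avg => bs; rewrite add1n eqSS.
rewrite !tl andbT andbF !IH /=.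
case: b {tl} => /=.
  rewrite -[RHS]/(coin_step p (error_weight p s m) e.*2) /coin_step odd_double.
  by case: e => [|e] /=; rewrite ?mulr0.
case: e => [|e]; first by rewrite !mulr0 addr0.
rewrite -[RHS]/(coin_step p (error_weight p s m) e.*2.+1) /coin_step /=
  odd_double /=.
by rewrite (IH true) addrC.
Qed.

Lemma prob_correctE {R : realType} (p : R) (n k : nat)
    (m := (n.+1 - cutoff p)%N) :
    0 < p -> p < 1 -> (k <= n.+1)%N ->
  prob_correct p n.+1 k = error_weight p (n - m) m (n.+1 - k).*2.
Proof.
move=> p0 p1 kn; have [_ cut0] := cutoff_gt0 p p0 p1.
have mn : (m <= n)%N by rewrite /m; lia.
rewrite -[RHS](coin_avg_errors p (n - m) m (n.+1 - k) true) subnKC //.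
rewrite -coin_avg_take -sum_coins /prob_correct big_mkcond /=.
apply: eq_bigr => eps _.
have := num_correctE p n eps p0 p1; rewrite -/m; set e := errors _ _ _ => Ee.
have -> : (e == n.+1 - k)%N = (num_correct p eps == k) by lia.
by case: eqP => _; rewrite ?mulr1 ?mulr0.
Qed.

Lemma prob_correct_too_many {R : realType} (p : R) (n k : nat) :
  0 < p -> p < 1 -> (n.+1 < k)%N -> prob_correct p n.+1 k = 0.
Proof.
move=> p0 p1 nk; rewrite /prob_correct big_pred0 // => eps.
by have := num_correctE p n eps p0 p1; lia.
Qed.

(** * Log-concavity *)

(** Small values of [k] correspond to many errors, so log-concavity is that of
    the number of errors read backwards.  When [m > 0] the tail has
    [cutoff p - 1] coins: none if [p >= 1/2], and otherwise few enough by
    [cutoff_small_p]. *)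
Theorem theorem3 (R : realType) (p : R) (n k : nat)
    (p_gt0 : 0 < p) (p_lt1 : p < 1) (n_ge1 : (1 <= n)%N) (k_ge1 : (1 <= k)%N) :
  prob_correct p n (k - 1)%N * prob_correct p n (k + 1)%N <= prob_correct p n k ^+ 2.
Proof.
case: n n_ge1 => [//|n] _.
have [nk|kn] := ltnP n.+1 (k + 1).
  by rewrite [prob_correct p _ (k + 1)]prob_correct_too_many // mulr0 sqr_ge0.
rewrite !prob_correctE //; try lia.
set m := (n.+1 - cutoff p)%N; set e := (n.+1 - (k + 1))%N.
have -> : (n.+1 - (k - 1) = e.+2)%N by lia.
have -> : (n.+1 - k = e.+1)%N by lia.
rewrite !doubleS mulrC; apply: error_weight_log_concave => //.
case: (posnP m) => [->|m_gt0]; [by left | right].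
have [half_p|p_half] := leP 2^-1 p.
  by right; rewrite /m cutoff_large_p //; lia.
have [_ cut0] := cutoff_gt0 p p_gt0 p_lt1.
left; have -> : (n - m).+1 = cutoff p by move: m_gt0; rewrite /m; lia.
exact: cutoff_small_p.
Qed.
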